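(* Let $\mathscr{A}$ be an alphabet with $|\mathscr{A}| \geq 2$ and let $k$ be a positive integer. Consider monoid presentations over $\mathscr{A}$ with exactly $k$ relations and sum relation length $n$ (respectively, maximum relation length $n$). As $n \to \infty$, the proportion of such presentations which present left cancellative monoids tends to $\left( \frac{|\mathscr{A}|-1}{|\mathscr{A}|} \right)^{k}$, the proportion which present right cancellative monoids tends to $\left( \frac{|\mathscr{A}|-1}{|\mathscr{A}|} \right)^{k}$, and the proportion which present cancellative monoids tends to $\left( \frac{|\mathscr{A}|-1}{|\mathscr{A}|} \right)^{2k}$.
   Context: A monoid presentation $\langle \mathscr{A} \mid \mathscr{R} \rangle$ consists of an alphabet $\mathscr{A}$ and a set $\mathscr{R} \subseteq \mathscr{A}^* \times \mathscr{A}^*$ of relations (pairs of words); it has $k$ relations if $|\mathscr{R}| = k$. The monoid presented is $\mathscr{A}^*$ modulo the smallest congruence containing $\mathscr{R}$. The sum relation length is the total length of all words forming sides of relations, and the maximum relation length is the length of the longest word forming a side of a relation (or $0$ if there are none). A monoid is left [right] cancellative if $xy = xz$ [$yx = zx$] implies $y = z$, and cancellative if it is both. *)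

(* Defs.v *)
From HB Require Import structures.
From mathcomp Require Import all_boot all_order all_algebra.
From mathcomp Require Import finmap.
From mathcomp Require Import all_classical all_reals all_analysis.
Set Implicit Arguments. Unset Strict Implicit. Unset Printing Implicit Defensive.
Import Order.TTheory GRing.Theory Num.Theory.

Local Open Scope fset_scope.

Section Presentations.
Variable A : finType.

Definition relation := (seq A * seq A)%type.

Definition presentation := {fset relation}.

Inductive cong (R : presentation) : seq A -> seq A -> Prop :=
| cong_rel u v : (u, v) \in R -> cong R u v
| cong_refl w : cong R w w
| cong_sym u v : cong R u v -> cong R v u
| cong_trans u v w : cong R u v -> cong R v w -> cong R u w
| cong_compat x y u v : cong R u v -> cong R (x ++ u ++ y) (x ++ v ++ y).

Definition left_cancellative (R : presentation) : Prop :=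
  forall x y z : seq A, cong R (x ++ y) (x ++ z) -> cong R y z.
Definition right_cancellative (R : presentation) : Prop :=
  forall x y z : seq A, cong R (y ++ x) (z ++ x) -> cong R y z.
Definition cancellative (R : presentation) : Prop :=
  left_cancellative R /\ right_cancellative R.

Definition sum_rel_len (R : presentation) : nat :=
  \sum_(p <- R) (size p.1 + size p.2).
Definition max_rel_len (R : presentation) : nat :=
  \max_(p <- R) maxn (size p.1) (size p.2).

Definition words_upto (n : nat) : seq (seq A) :=
  flatten [seq [seq tval t | t : m.-tuple A] | m <- iota 0 n.+1].

(* all relations whose two sides have length at most n; every presentation
   with sum (or maximum) relation length n is a subset of this set *)
Definition rels_upto (n : nat) : {fset relation} :=
  seq_fset tt [seq (u, v) | u <- words_upto n, v <- words_upto n].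

Definition num_pres (len : presentation -> nat) (k n : nat)
  (P : presentation -> Prop) : nat :=
  #|` [fset R in fpowerset (rels_upto n) |
        [&& #|` R| == k, len R == n & `[< P R >]]] |.

Definition proportion (Rl : realType) (len : presentation -> nat) (k n : nat)
  (P : presentation -> Prop) : Rl :=
  ((num_pres len k n P)%:R / (num_pres len k n (fun _ => True))%:R)%R.

End Presentations.

(* Main.v *)
(** Call a set of relations generic when every relation word has length at least
    [3 * l] and every factor of length [l] occurs at only one place among all the
    relation words.  In a rewriting chain over a generic presentation, an interior
    factor of a relation word can only be modified within its last [l] letters; hence
    after replacing a prefix [u] by its partner [v], the next rewriting at the left end
    of the word must replace [v] by [u] again.  If the two sides of each relation start
    with different letters, induction on the length of the chain yields left
    cancellativity; conversely, if both sides start with the same letter [a], the two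
    words obtained by erasing it contain no relation word, so they are not congruent.
    Right cancellativity is dual.

    A presentation with [k] ordered relations is the same as a list of [2 k] lengths
    together with a single word, the concatenation of the sides.  For a fixed list of
    lengths, a word has two equal factors of length [l] with probability at most
    [N ^ 2 / #|A| ^ l], where [N] is its length, and the events "these two letters
    differ" at disjoint pairs of positions are independent of probability
    [(#|A| - 1) / #|A|].  With [l = 3 log2 n], non-generic presentations form a
    fraction [O(log n / n)]. *)

Require Import Defs.
From HB Require Import structures.
From mathcomp Require Import all_boot all_order all_algebra.
From mathcomp Require Import finmap.
From mathcomp Require Import all_classical all_reals all_analysis.
From mathcomp Require Import zify ring lra.
Import Order.TTheory GRing.Theory Num.Theory numFieldNormedType.Exports.
Set Implicit Arguments. Unset Strict Implicit. Unset Printing Implicit Defensive.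

(** * Rewriting with small overlaps *)

Section Rewriting.
Variables (A : eqType) (E : seq A -> seq A -> Prop).

Definition step (w w' : seq A) : Prop :=
  exists p u v s, [/\ E u v, w = p ++ u ++ s & w' = p ++ v ++ s].

Fixpoint steps n (w w' : seq A) : Prop :=
  if n is m.+1 then exists2 w1, steps m w w1 & step w1 w' else w = w'.

Lemma steps_trans n1 n2 w1 w2 w3 :
  steps n1 w1 w2 -> steps n2 w2 w3 -> steps (n1 + n2) w1 w3.
Proof.
elim: n2 w3 => [|n2 IH] w3 s12 /=; first by move=> <-; rewrite addn0.
by case=> w s2w sw3; rewrite addnS; exists w => //; apply: IH.
Qed.

Lemma steps_cat n p s w w' : steps n w w' -> steps n (p ++ w ++ s) (p ++ w' ++ s).
Proof.
elim: n w' => [|n IH] w' /=; first by move=> ->.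
case=> w1 /IH sw [p' [u [v [s' [Euv e1 e2]]]]]; exists (p ++ w1 ++ s) => //.
by exists (p ++ p'), u, v, (s' ++ s); rewrite e1 e2 !catA.
Qed.

Lemma steps_sym n w w' : (forall u v, E u v -> E v u) ->
  steps n w w' -> steps n w' w.
Proof.
move=> symE; elim: n w' => [|n IH] w' /=; first by move=> ->.
case=> w1 /IH s1 [p [u [v [s [Euv e1 e2]]]]].
suff: steps (1 + n) w' w by []; apply: steps_trans s1.
by exists w' => //; exists p, v, u, s; split=> //; apply: symE.
Qed.

End Rewriting.

Section SmallOverlap.
Variables (A : eqType).
Implicit Types (E : seq A -> seq A -> Prop) (l : nat).

(** Genericity, stated for a symmetric relation between relation words. In [so_piece], the
    equalities [p = p'] and [s = s'] also force [u = u'], so distinct relation words share no factor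
    of length [l]. *)
Record small_overlap l E : Prop := SmallOverlap {
  so_pos : 0 < l;
  so_sym : forall u v, E u v -> E v u;
  so_irr : forall u, ~ E u u;
  so_fun : forall u v v', E u v -> E u v' -> v = v';
  so_long : forall u v, E u v -> 3 * l <= size u;
  so_piece : forall u v u' v' p x s p' s', E u v -> E u' v' ->
    u = p ++ x ++ s -> u' = p' ++ x ++ s' -> l <= size x -> p = p' /\ s = s' }.

Lemma cat_split (a b c d : seq A) : a ++ b = c ++ d -> size c <= size a ->
  exists2 r, a = c ++ r & d = r ++ b.
Proof.
move=> e le; have ea : a = c ++ drop (size c) a.
  rewrite -{1}[a](cat_take_drop (size c)); congr (_ ++ _).
  by have := congr1 (take (size c)) e; rewrite takel_cat // take_size_cat.
exists (drop (size c) a) => //; move: e; rewrite {1}ea -catA => /eqP.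
by rewrite eqseq_cat // eqxx /= => /eqP.
Qed.

Variables (l : nat) (E : seq A -> seq A -> Prop).
Hypothesis soE : small_overlap l E.

(** The nonempty [p0] is missing from the rewritten word, so [m] is not at the start of its relation
    word; the [l] letters of [q] shield [m] from changes coming from the right. *)
Definition rigid n := forall p0 m q e u1 w s, p0 <> [::] -> E (p0 ++ m ++ q ++ e) u1 ->
  size q = l -> steps E n (m ++ q ++ s) w ->
  exists2 t, w = m ++ t & steps E n (q ++ s) t.

(* Reading the chain backwards from the first step that touches [m], the rest of
   [u] is itself rigid, so [q] already was a factor of [u]. *)
Lemma rigid_step n p0 m q e u1 s t p u v s' : rigid n ->
  E (p0 ++ m ++ q ++ e) u1 -> size q = l -> steps E n (q ++ s) t ->
  E u v -> m ++ t = p ++ u ++ s' -> size p < size m ->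
  [/\ p0 = [::], p = [::] & u = m ++ q ++ e].
Proof.
have [l0 symE _ _ longE pieceE] := soE.
move=> rig Eu1 sq st Euv eq ltpm.
have [m2 em eus] := cat_split eq (ltnW ltpm).
have m20 : m2 <> [::] by move=> m20; move: ltpm; rewrite em m20 cats0 ltnn.
have lu := longE _ _ Euv.
have [le|/ltnW le] := leqP (size u) (size m2).
  have [m3 em2 es'] := cat_split (esym eus) le.
  have [] := pieceE _ _ _ _ (p0 ++ p) u (m3 ++ q ++ e) [::] [::] Eu1 Euv.
  - by rewrite em em2 !catA.
  - by rewrite cats0.
  - by lia.
  case: p0 Eu1 => // Eu1; case: p eq ltpm em => // eq ltpm em _ e3.
  by rewrite em em2 /= -catA e3 cats0.
have [r eu et] := cat_split eus le.
have [lm2|lm2] := leqP l (size m2).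
  have [] := pieceE _ _ _ _ (p0 ++ p) m2 (q ++ e) [::] r Eu1 Euv.
  - by rewrite em !catA.
  - by rewrite eu.
  - by [].
  case: p0 Eu1 => // Eu1; case: p eq ltpm em => // eq ltpm em _ e3.
  by rewrite em eu e3.
(* The bound [3 * l] is spent here. Fewer than [l] letters of [u] lie in [m]; of the others, the
   last [l] act as a shield, and at least [l] remain, enough to cover [q]. *)
have sr : 2 * l <= size r by have := congr1 size eu; rewrite size_cat; lia.
have er := cat_take_drop (size r - l) r.
set r1 := take _ r in er; set q1 := drop _ r in er.
have sr1 : size r1 = size r - l by rewrite size_takel // leq_subr.
have sq1 : size q1 = l by rewrite size_drop; lia.
have [] := rig m2 r1 q1 [::] v (q ++ s) s' m20 _ sq1.
- by rewrite cats0 er -eu.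
- by apply: steps_sym => //; rewrite catA er -et.
move=> t'' e1 _.
have [|r2 er1 _] := cat_split (esym e1); first by rewrite sr1 sq; lia.
have [] := pieceE _ _ _ _ (p0 ++ m) q e m2 (r2 ++ q1) Eu1 Euv.
- by rewrite !catA.
- by rewrite eu -er er1 -!catA.
- by rewrite sq.
move=> e2 e3; have := congr1 size e2; rewrite em !size_cat => e4.
have /size0nil p00 : size p0 = 0 by lia.
have /size0nil pp0 : size p = 0 by lia.
by rewrite pp0 eu -er er1 -e2 p00 /= em pp0 /= e3 -!catA.
Qed.

(** By [rigid_step], a step starting inside [m] would force [p0] to be empty; every other step acts
    after [m]. *)
Lemma rigidP n : rigid n.
Proof.
elim: n => [|n IH] p0 m q e u1 w s p00 Eu1 sq /=.
  by move=> <-; exists (q ++ s).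
case=> w1 /(IH _ _ _ _ _ _ _ p00 Eu1 sq)[t ew1 st].
case=> p [u [v [s' [Euv ew1' ew]]]].
rewrite ew1 in ew1'.
have [lt|le] := ltnP (size p) (size m).
  by have [] := rigid_step IH Eu1 sq st Euv ew1' lt.
have [p' ep et] := cat_split (esym ew1') le.
exists (p' ++ v ++ s'); first by rewrite ew ep -catA.
by exists t => //; exists p', u, v, s'; split.
Qed.

(** With nothing missing on the left, [rigid_step] says that the first step starting inside [m]
    rewrites exactly [m ++ q]. The chain is cut at that step. *)
Lemma steps_from_word n m q v w s : E (m ++ q) v -> size q = l ->
  steps E n (m ++ q ++ s) w ->
  (exists2 t, w = m ++ t & steps E n (q ++ s) t) \/
  exists n1 n2 s' u, [/\ n1 + n2 < n, steps E n1 (q ++ s) (q ++ s'),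
    E (m ++ q) u & steps E n2 (u ++ s') w].
Proof.
move=> Ev sq; elim: n w => [|n IH] w /=; first by move=> <-; left; exists (q ++ s).
case=> w1 /IH[].
  case=> t ew1 st [p [u [v' [s' [Euv ew1' ew]]]]]; rewrite ew1 in ew1'.
  have [lt|le] := ltnP (size p) (size m).
    have Ev' : E ([::] ++ m ++ q ++ [::]) v by rewrite cats0.
    have [_ p0 eu] := rigid_step (@rigidP n) Ev' sq st Euv ew1' lt.
    right; exists n, 0, s', v'; split=> //; first by rewrite addn0.
    - move: ew1'; rewrite p0 eu cats0 /= -!catA => /eqP.
      by rewrite eqseq_cat // eqxx /= => /eqP <-.
    - by move: Euv; rewrite eu cats0.
    - by rewrite ew p0.
  have [p' ep et] := cat_split (esym ew1') le.
  left; exists (p' ++ v' ++ s'); first by rewrite ew ep -catA.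
  by exists t => //; exists p', u, v', s'; split.
case=> n1 [n2 [s' [u [ltn st Eu st2]]]] sw; right.
by exists n1, n2.+1, s', u; split=> //; [rewrite addnS|exists w1].
Qed.

(** The chain is cut at its first step at the left end; the earlier steps keep [a] and act on
    [y]. *)
Lemma steps_from_letter n a y w : steps E n (a :: y) w ->
  (exists2 y', w = a :: y' & steps E n y y') \/
  exists n1 n2 u v s, [/\ n1 + n2 < n, E (a :: u) v, steps E n1 y (u ++ s)
    & steps E n2 (v ++ s) w].
Proof.
elim: n w => [|n IH] w /=; first by move=> <-; left; exists y.
case=> w1 /IH[].
  case=> y' -> st [[|b p] [u [v [s [Euv ew1 ew]]]]].
    case: u Euv ew1 => [|b u] Euv.
      by have := so_long soE Euv; have := so_pos soE; rewrite /=; lia.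
    case=> eab ey'; right; exists n, 0, u, v, s; split=> //; rewrite ?addn0 ?eab -?ey' //.
  case: ew1 => eab ey'; left; exists (p ++ v ++ s); first by rewrite ew eab.
  by exists y' => //; exists p, u, v, s.
case=> n1 [n2 [u [v [s [ltn Euv s1 s2]]]]] sw; right.
by exists n1, n2.+1, u, v, s; split=> //; [rewrite addnS|exists w1].
Qed.

(** The bound [N] allows a use inside the strong induction of [steps_cancel], where a letter can be
    cancelled only in shorter chains. *)
Lemma steps_cancel_seq N x y z n :
  (forall n a y z, n <= N -> steps E n (a :: y) (a :: z) ->
     exists2 n', n' <= n & steps E n' y z) ->
  n <= N -> steps E n (x ++ y) (x ++ z) -> exists2 n', n' <= n & steps E n' y z.
Proof.
move=> H; elim: x n => [|a x IH] n le /=; first by exists n.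
move=> /(H _ _ _ _ le)[n' le' /IH[|n'' le'' st]]; first exact: leq_trans le.
by exists n'' => //; apply: leq_trans le'.
Qed.

Lemma steps_cancel n a y z : (forall u v, E u v -> ohead u <> ohead v) ->
  steps E n (a :: y) (a :: z) -> exists2 n', n' <= n & steps E n' y z.
Proof.
move=> hd; elim/ltn_ind: n a y z => n IH a y z.
case/steps_from_letter => [[y' [<-] st]|]; first by exists n.
case=> n1 [n2 [u [v [s [ltn Euv s1 s2]]]]].
have l0 := so_pos soE; have Evu := so_sym soE Euv.
have lv := so_long soE Evu.
have := cat_take_drop (size v - l) v.
set m := take _ v; set q := drop _ v => ev.
have sq : size q = l by rewrite size_drop; lia.
have sm : size m = size v - l by rewrite size_takel // leq_subr.
rewrite -ev -catA in s2; rewrite -ev in Evu.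
(* If [m] survived to the end, [v] would start with [a], like its partner [a :: u]. *)
case: (steps_from_word Evu sq s2) => [[t ez _]|].
  have := hd _ _ Euv; rewrite -ev; case: m ez sm {ev s2 Evu} => [|b m] /=; first by lia.
  by case=> ->.
case=> n3 [n4 [s' [u' [ltn2 s3 Eu' s4]]]].
have eu' : u' = a :: u by apply: (so_fun soE Eu'); exact: Evu.
rewrite eu' /= in s4.
(* The chain now returns from [v] to [a :: u]. Cancelling [q] before the return and [a] after it
   leaves [y] to [u ++ s] to [u ++ s'] to [z], in no more steps than before. *)
have [|n5 le5 s5] := @steps_cancel_seq n3 q s s' n3 _ (leqnn _) s3.
  by move=> n0 b y0 z0 le0; apply: IH; lia.
have [|n6 le6 s6] := IH n4 _ _ _ _ s4; first by lia.
exists (n1 + n5 + n6); first by lia.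
apply: steps_trans s6; apply: (steps_trans s1).
by have := steps_cat u [::] s5; rewrite !cats0.
Qed.

Lemma steps_left_cancellative :
  (forall u v, E u v -> ohead u <> ohead v) <->
  (forall x y z, (exists n, steps E n (x ++ y) (x ++ z)) -> exists n, steps E n y z).
Proof.
split=> [hd x y z [n st]|lc u v Euv].
  have [|n' _ st'] := @steps_cancel_seq n x y z n _ (leqnn _) st; last by exists n'.
  by move=> n0 a y0 z0 _; apply: steps_cancel.
have l0 := so_pos soE.
have := so_long soE Euv; have := so_long soE (so_sym soE Euv).
case: u v Euv => [|a u] [|b v] Euv /=; try lia.
move=> _ _ [eab]; rewrite -eab in Euv *.
have [|n] := lc [:: a] u v.
  by exists 1 => /=; exists (a :: u) => //; exists [::], (a :: u), (a :: v), [::]; rewrite !cats0.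
(* No step starts from [u]: a relation word inside [u] would also be a factor of [a :: u], at a
   place other than its own. *)
suff: forall w, steps E n u w -> u = w.
  by move=> H /H euv; apply: (so_irr soE (u := a :: u)); rewrite {2}euv.
elim: n => [|n IH] w //= [w1 /IH <-] [p [u' [v' [s [Euv' eu _]]]]].
have [] := so_piece soE (p := a :: p) (x := u') (s := s) (p' := [::]) (s' := [::]) Euv Euv'.
- by rewrite eu.
- by rewrite cats0.
- by have := so_long soE Euv'; lia.
by [].
Qed.

End SmallOverlap.

(** * Right cancellation by reversal of words *)

Section Reversal.
Variables (A : eqType) (E : seq A -> seq A -> Prop).

Definition rev_rel (u v : seq A) := E (rev u) (rev v).

Lemma steps_rev n w w' : steps E n w w' -> steps rev_rel n (rev w) (rev w').
Proof.
elim: n w' => [|n IH] w' /=; first by move=> ->.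
case=> w1 /IH s1 [p [u [v [s [Euv e1 e2]]]]]; exists (rev w1) => //.
exists (rev s), (rev u), (rev v), (rev p).
by rewrite /rev_rel !revK e1 e2 !rev_cat !catA.
Qed.

Lemma small_overlap_rev l : small_overlap l E -> small_overlap l rev_rel.
Proof.
case=> l0 symE irrE funE longE pieceE; split=> //.
- by move=> u v; apply: symE.
- by move=> u; apply: irrE.
- by move=> u v v' E1 E2; rewrite -[v]revK -[v']revK (funE _ _ _ E1 E2).
- by move=> u v /longE; rewrite size_rev.
- move=> u v u' v' p x s p' s' E1 E2 eu eu' lx.
  have [] := pieceE _ _ _ _ (rev s) (rev x) (rev p) (rev s') (rev p') E1 E2.
  + by rewrite eu !rev_cat catA.
  + by rewrite eu' !rev_cat catA.
  + by rewrite size_rev.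
  by move=> /(can_inj revK) -> /(can_inj revK) ->.
Qed.

End Reversal.

Lemma steps_right_cancellative (A : eqType) l (E : seq A -> seq A -> Prop) :
  small_overlap l E ->
  (forall u v, E u v -> ohead (rev u) <> ohead (rev v)) <->
  (forall x y z, (exists n, steps E n (y ++ x) (z ++ x)) -> exists n, steps E n y z).
Proof.
move=> soE.
have H := steps_left_cancellative (small_overlap_rev soE).
have K n w w' : steps (rev_rel E) n (rev w) (rev w') -> steps E n w w'.
  move=> /steps_rev; rewrite !revK.
  elim: n w' => //= n IH w' [w1 /IH s1 [p [u [v [s [Euv e1 e2]]]]]]; exists w1 => //.
  by exists p, u, v, s; move: Euv; rewrite /rev_rel !revK.
split=> [hd x y z [n st]|rc].
  have [||m /K st'] := H.1 _ (rev x) (rev y) (rev z); last by exists m.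
    by move=> u v /hd; rewrite !revK.
  by exists n; rewrite -!rev_cat; apply: steps_rev.
move=> u v Euv; apply: H.2; last by rewrite /rev_rel !revK.
move=> x y z [n st]; have [|m /steps_rev] := rc (rev x) (rev y) (rev z).
  by exists n; apply: K; rewrite !rev_cat !revK.
by rewrite !revK; exists m.
Qed.

(** * Counting words *)

Section TupleCounting.
Variables (A : finType) (x0 : A).

Definition repeat_at l (t : seq A) i j :=
  [forall c : 'I_l, nth x0 t (i + c) == nth x0 t (j + c)].

Definition has_repeat l N (t : seq A) :=
  [exists p : 'I_N * 'I_N,
     [&& p.1 < p.2, p.2 + l <= N & repeat_at l t p.1 p.2]].

(* A word with equal factors at [i < j] is determined by the letters outside
   the second factor, read from left to right, even if the factors overlap. *)
Lemma card_repeat_at l N i j : i < j -> j + l <= N ->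
  #|[set t : N.-tuple A | repeat_at l t i j]| <= #|A| ^ (N - l).
Proof.
move=> ij jl.
pose f (t : N.-tuple A) := [tuple nth x0 t (if r < j then val r else r + l) | r < N - l].
rewrite -card_tuple -[X in _ <= X]cardsT -(card_in_imset (f := f)).
  exact: subset_leq_card (finset.subsetT _).
move=> t1 t2; rewrite !inE => /forallP r1 /forallP r2 ef.
have ef' r : r < N - l -> nth x0 t1 (if r < j then r else r + l) =
                          nth x0 t2 (if r < j then r else r + l).
  by move=> lr; have := congr1 (fun t => tnth t (Ordinal lr)) ef; rewrite !tnth_mktuple.
apply: val_inj; apply: (@eq_from_nth _ x0); rewrite !size_tuple // => r.
elim/ltn_ind: r => r IH lr.
have [rj|jr] := ltnP r j; first by have := ef' r; rewrite rj; apply; lia.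
have [rl|lrj] := ltnP r (j + l).
  have lc : r - j < l by lia.
  have /eqP := r1 (Ordinal lc); have /eqP := r2 (Ordinal lc) => /=.
  rewrite subnKC // => <- <-; apply: IH; lia.
have := ef' (r - l); rewrite [r - l < j](_ : _ = false); last by lia.
by rewrite subnK; [apply; lia | lia].
Qed.

Lemma card_has_repeat l N :
  #|[set t : N.-tuple A | has_repeat l N t]| <= N ^ 2 * #|A| ^ (N - l).
Proof.
pose S (p : 'I_N * 'I_N) := [set t : N.-tuple A |
  [&& p.1 < p.2, p.2 + l <= N & repeat_at l t p.1 p.2]].
have -> : [set t : N.-tuple A | has_repeat l N t] = \bigcup_p S p.
  apply/setP => t; rewrite inE; apply/existsP/finset.bigcupP => [[p h]|[p _]].
    by exists p => //; rewrite inE.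
  by rewrite inE; exists p.
apply: (@leq_trans (\sum_(p : 'I_N * 'I_N) #|S p|)).
  elim/big_rec2: _ => [|p m U _ le]; first by rewrite cards0.
  by apply: (leq_trans (leq_card_setU _ _)); rewrite leq_add2l.
apply: (@leq_trans (\sum_(p : 'I_N * 'I_N) #|A| ^ (N - l))); last first.
  by rewrite sum_nat_const card_prod !card_ord mulnn.
apply: leq_sum => -[i j] _.
have [/andP[ij jl]|] := boolP ((i < j) && (j + l <= N)).
  apply: leq_trans (card_repeat_at ij jl); apply: subset_leq_card.
  by apply/fintype.subsetP => t; rewrite !inE /= => /and3P[].
move=> h; rewrite [S _](_ : _ = finset.set0) ?cards0 //; apply/setP => t.
by rewrite !inE /=; apply/negbTE; apply: contra h => /and3P[-> ->].
Qed.

Definition distinct_at (ps : seq (nat * nat)) (t : seq A) :=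
  all (fun p => nth x0 t p.1 != nth x0 t p.2) ps.

(** The positions are pairwise distinct, so the pairs in the tail never test the letter at [j].
    Overwriting it is a bijection from [X] times the alphabet onto [S], so the equality of letters
    [i] and [j] holds for exactly one word of [S] in [#|A|]. The product form avoids a division. *)
Lemma card_distinct_at N ps :
  uniq (unzip1 ps ++ unzip2 ps) -> all (gtn N) (unzip1 ps ++ unzip2 ps) ->
  #|[set t : N.-tuple A | distinct_at ps t]| * #|A| ^ size ps =
  #|A| ^ N * (#|A| - 1) ^ size ps.
Proof.
elim: ps => [|[i j] ps IH].
  move=> _ _; rewrite /= !expn0 !muln1 -card_tuple -cardsT.
  by congr #|pred_of_set _|; apply/setP => t; rewrite !inE.
rewrite /= !cat_uniq !all_cat /= mem_cat inE !negb_or -!andbA.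
move=> /and5P[i1 ij i2 u1 /and4P[j1 nn j2 u2]] /and4P[iN a1 jN a2].
rewrite cat_uniq u1 nn u2 all_cat a1 a2 in IH.
have {}IH := IH isT isT.
set S := [set t : N.-tuple A | distinct_at ps t] in IH *.
pose X := [set t in S | nth x0 t i == nth x0 t j].
have -> : [set t : N.-tuple A | distinct_at ((i, j) :: ps) t] = S :\: X.
  by apply/setP => t; rewrite !inE /distinct_at /=; case: (all _ _); rewrite ?andbT ?andbF.
have XS : X \subset S by apply/fintype.subsetP => t; rewrite inE => /andP[].
pose upd (p : N.-tuple A * A) := [tuple if val r == j then p.2 else tnth p.1 r | r < N].
have nth_upd p r : r < N -> nth x0 (upd p) r = if r == j then p.2 else nth x0 p.1 r.
  by move=> rN; rewrite -(tnth_nth x0 (upd p) (Ordinal rN)) tnth_mktuple (tnth_nth x0).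
have updS p : (upd p \in S) = (p.1 \in S).
  rewrite !inE; apply: eq_in_all => -[a b] abps /=.
  have ain : a \in unzip1 ps by apply/mapP; exists (a, b).
  have bin : b \in unzip2 ps by apply/mapP; exists (a, b).
  have aN : a < N := allP a1 _ ain; have bN : b < N := allP a2 _ bin.
  rewrite !nth_upd //.
  have -> : (a == j) = false by apply/negbTE; apply: contra j1 => /eqP <-.
  suff -> : (b == j) = false by [].
  by apply/negbTE; apply: contra j2 => /eqP <-.
have cX : #|X| * #|A| = #|S|.
  rewrite -cardsT -cardsX -(card_in_imset (f := upd)).
    congr #|pred_of_set _|; apply/setP => t; apply/imsetP/idP.
      by case=> p; rewrite inE => /andP[]; rewrite inE => /andP[pS _] _ ->; rewrite updS.
    move=> tS; exists (upd (t, nth x0 t i), nth x0 t j).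
      by rewrite finset.in_setX finset.in_setT andbT finset.in_set -/S updS tS !nth_upd // eqxx (negbTE ij) /=.
    apply: val_inj; apply: (@eq_from_nth _ x0); rewrite !size_tuple // => r rN.
    by rewrite !nth_upd //=; case: eqP => [->|].
  move=> [t a] [t' a']; rewrite !inE /= !andbT => /andP[_ /eqP e] /andP[_ /eqP e'] eu.
  have en r : r < N -> (if r == j then a else nth x0 t r) = if r == j then a' else nth x0 t' r.
    by move=> rN; rewrite -(nth_upd (t, a)) // -(nth_upd (t', a')) // eu.
  have := en j jN; rewrite eqxx => ->; congr (_, _).
  apply: val_inj; apply: (@eq_from_nth _ x0); rewrite !size_tuple // => r rN.
  have [->|rj] := eqVneq r j; last by have := en r rN; rewrite (negbTE rj).
  by rewrite -e -e'; have := en i iN; rewrite (negbTE ij).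
have -> : #|S :\: X| = #|S| - #|X| by rewrite cardsD (finset.setIidPr XS).
rewrite !expnS [RHS]mulnCA -IH -cX -{2}[#|X|]muln1 -mulnBr.
by rewrite -[in RHS]mulnA [RHS]mulnCA [RHS]mulnA.
Qed.

End TupleCounting.

(** * Shapes of presentations *)

(** Entries bounded by [n] keep the set of shapes finite, and lose nothing: no side is longer than
    the total or maximal length [n]. *)
Definition natseq m n (d : m.-tuple 'I_n.+1) : seq nat := map val d.

Lemma size_natseq m n (d : m.-tuple 'I_n.+1) : size (natseq d) = m.
Proof. by rewrite size_map size_tuple. Qed.

Section Shapes.
Variables (a m n : nat) (lenf : seq nat -> nat).
Implicit Types d : m.-tuple 'I_n.+1.

(** Over an alphabet of [a] letters, this counts the coded lists of relations of length [n],
    including those with repeated relations. *)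
Definition weight : nat :=
  \sum_(d : m.-tuple 'I_n.+1 | lenf (natseq d) == n) a ^ sumn (natseq d).

Definition short_weight L : nat :=
  \sum_(d : m.-tuple 'I_n.+1 | (lenf (natseq d) == n) && ~~ all (leq L) (natseq d))
    a ^ sumn (natseq d).

Definition short_weight_at L (i : 'I_m) : nat :=
  \sum_(d : m.-tuple 'I_n.+1 | (lenf (natseq d) == n) && (tnth d i < L))
    a ^ sumn (natseq d).

Lemma sumn_natseq d : sumn (natseq d) = \sum_(r < m) tnth d r.
Proof. by rewrite sumnE big_map big_tuple. Qed.

Lemma short_weight_le L : short_weight L <= \sum_i short_weight_at L i.
Proof.
rewrite (exchange_big_dep (fun d => lenf (natseq d) == n)) /= => [|i d _ /andP[] //].
apply: (@leq_trans (\sum_(d : m.-tuple 'I_n.+1 |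
    (lenf (natseq d) == n) && ~~ all (leq L) (natseq d))
  \sum_(i < m | (lenf (natseq d) == n) && (tnth d i < L)) a ^ sumn (natseq d))).
  apply: leq_sum => d /andP[ld /allPn[x /mapP[y /tnthP[i ->] ->]]].
  rewrite -ltnNge => lt; rewrite (bigD1 i) ?ld ?lt //=; exact: leq_addr.
by rewrite big_mkcondr /=; apply: leq_sum => d _; case: ifP.
Qed.

End Shapes.

Lemma leq_sum_inj (I J : finType) (P : pred I) (Q : pred J) (f : I -> J) (F : J -> nat) :
  {in P &, injective f} -> (forall i, P i -> Q (f i)) ->
  \sum_(i | P i) F (f i) <= \sum_(j | Q j) F j.
Proof.
move=> finj PQ; rewrite -(big_imset _ finj) /=.
rewrite [X in _ <= X](bigID (mem (f @: P))) /=.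
rewrite (eq_bigl (fun j => Q j && (j \in f @: P))) ?leq_addr // => j.
by case: (boolP (j \in _)) => [/imsetP[i Pi ->]|]; rewrite ?andbF // PQ.
Qed.

(** * Rarity of short sides for the sum length *)

Section SumShapes.
Variables (a m n L : nat).
Local Notation wt := (weight a m.+2 n sumn).

Let sumnE' p (d : p.-tuple 'I_n.+1) : sumn (natseq d) = \sum_(r <- d) r.
Proof. by rewrite sumnE big_map. Qed.

(** Stars and bars count the shapes, and each of them carries [a ^ n] words. *)
Lemma weight_sum : wt = 'C(m.+1 + n, m.+1) * a ^ n.
Proof.
rewrite -card_ord_partitions cardsE -sum_nat_const.
apply: eq_big => d; first by rewrite unfold_in /= sumnE'.
by move/eqP ->.
Qed.

(* Given the entry [i], it can be merged into another entry. *)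
Lemma short_weight_at_sum (i : 'I_m.+2) :
  short_weight_at a n sumn L i <= L * 'C(m + n, m) * a ^ n.
Proof.
(* The removed entry is added to the first remaining one. The total [n] bounds the result, so
   [inord] does not truncate. *)
pose g (d : m.+2.-tuple 'I_n.+1) : m.+1.-tuple 'I_n.+1 :=
  [tuple inord (tnth d (lift i r) + (r == ord0) * tnth d i) | r < m.+1].
have sumd (d : m.+2.-tuple 'I_n.+1) : sumn (natseq d) = n ->
    tnth d i + \sum_(r < m.+1) tnth d (lift i r) = n.
  by rewrite sumn_natseq (bigD1_ord i).
have gE (d : m.+2.-tuple 'I_n.+1) r : sumn (natseq d) = n ->
    tnth (g d) r = tnth d (lift i r) + (r == ord0) * tnth d i :> nat.
  move=> /sumd; rewrite (bigD1 r) //= tnth_mktuple => e; rewrite inordK // ltnS.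
  by case: (r == ord0); lia.
have [->|L0] := posnP L.
  by rewrite /short_weight_at big_pred0 // => d; rewrite ltn0 andbF.
pose f (d : m.+2.-tuple 'I_n.+1) : 'I_L.-1.+1 * m.+1.-tuple 'I_n.+1 := (inord (tnth d i), g d).
rewrite -card_ord_partitions -(prednK L0) -{2}[L.-1.+1]card_ord -cardsT -cardsX.
rewrite -sum_nat_const.
apply: leq_trans (leq_sum_inj (f := f) (fun=> a ^ n) _ _).
- by apply: leq_sum => d /andP[/eqP -> _].
- move=> d d'; rewrite !unfold_in /= => /andP[/eqP sd ld] /andP[/eqP sd' ld'] ef.
  have := congr1 (fun p => val p.1) ef; rewrite /= !inordK // => ei.
  have eg : g d = g d' := congr1 snd ef.
  apply: eq_from_tnth => r; apply: val_inj => /=.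
  have [r' er|->] := unliftP i r; last by [].
  rewrite er.
  have := congr1 (fun t => val (tnth t r')) eg; rewrite /= !gE // ei.
  by move/eqP; rewrite eqn_add2r => /eqP.
- move=> d /andP[/eqP sd ld].
  rewrite /f finset.in_setX finset.in_setT finset.in_set big_tuple.
  rewrite (eq_bigr (fun r : 'I_m.+1 => tnth d (lift i r) + (r == ord0) * tnth d i)).
    2: by move=> r _; apply: gE.
  rewrite big_split /= [X in _ + X](bigD1 ord0) //= mul1n.
  rewrite (big1 _ (fun r => r != ord0)) => [|r /negbTE ->]; last by rewrite mul0n.
  by rewrite addn0 addnC sumd.
Qed.

(** Fixing one entry leaves one free part fewer, which by [mul_bin_diag] costs a factor of order
    [n]. The union bound over the entries gives the second factor [m.+2]. *)
Lemma short_weight_sum :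
  short_weight a m.+2 n sumn L * n <= m.+2 ^ 2 * L * wt.
Proof.
have h := short_weight_le a m.+2 n sumn L.
have {h}h : short_weight a m.+2 n sumn L <= m.+2 * (L * 'C(m + n, m) * a ^ n).
  apply: (leq_trans h); rewrite -[X in _ <= X * _]card_ord -sum_nat_const.
  by apply: leq_sum => i _; apply: short_weight_at_sum.
have le : n * 'C(m + n, m) <= m.+2 * 'C(m.+1 + n, m.+1).
  apply: (@leq_trans ((m.+1 + n) * 'C(m + n, m))); first by rewrite leq_mul2r leq_addl orbT.
  by rewrite [m + n]/((m.+1 + n).-1) mul_bin_diag leq_mul2r leqnSn orbT.
rewrite weight_sum; apply: (leq_trans (leq_mul h (leqnn n))).
set c := 'C(m + n, m) in le *; set c' := 'C(m.+1 + n, m.+1) in le *.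
rewrite [X in X <= _](_ : _ = m.+2 * L * a ^ n * (n * c)); last by lia.
rewrite [X in _ <= X](_ : _ = m.+2 * L * a ^ n * (m.+2 * c')); last by rewrite -mulnn; lia.
by rewrite leq_mul2l le orbT.
Qed.

End SumShapes.

(** * Rarity of short sides for the maximum length *)

Definition seqmax (d : seq nat) := \max_(x <- d) x.

Section MaxShapes.
Variables (a m n L : nat).
Hypothesis a2 : 1 < a.
Local Notation wt := (weight a m n seqmax).

Lemma seqmax_ge d x : x \in d -> x <= seqmax d.
Proof. by move=> xd; rewrite /seqmax (big_rem x) //= leq_maxl. Qed.

Lemma seqmax_natseq (d : m.-tuple 'I_n.+1) i : tnth d i = n :> nat -> seqmax (natseq d) = n.
Proof.
move=> e; apply/eqP; rewrite eqn_leq; apply/andP; split.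
  by apply/bigmax_leqP_seq => x /mapP[y _ ->] _; rewrite -ltnS ltn_ord.
have h : nat_of_ord (tnth d i) \in natseq d by apply: map_f; apply: mem_tnth.
by have := seqmax_ge h; rewrite e.
Qed.

(* Raising the entry [i] to [n] keeps the maximum equal to [n]. *)
Lemma short_weight_at_max (i : 'I_m) :
  short_weight_at a n seqmax L i * a ^ n <= L * a ^ L * wt.
Proof.
have [->|L0] := posnP L.
  by rewrite /short_weight_at big_pred0 // => d; rewrite ltn0 andbF.
pose g (d : m.-tuple 'I_n.+1) := [tuple if r == i then ord_max else tnth d r | r < m].
have gw (d : m.-tuple 'I_n.+1) : tnth d i < L ->
    a ^ sumn (natseq d) * a ^ n <= a ^ L * a ^ sumn (natseq (g d)).
  move=> ld; rewrite -!expnD leq_exp2l // !sumn_natseq (bigD1 i) //=.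
  rewrite [X in _ <= _ + X](bigD1 i) //= tnth_mktuple eqxx /=.
  rewrite [X in _ <= _ + (_ + X)](eq_bigr (fun r => nat_of_ord (tnth d r))); first by lia.
  by move=> r /negbTE ri; rewrite tnth_mktuple ri.
pose f (d : m.-tuple 'I_n.+1) : 'I_L.-1.+1 * m.-tuple 'I_n.+1 := (inord (tnth d i), g d).
rewrite /short_weight_at big_distrl /=.
apply: (@leq_trans (\sum_(d : m.-tuple 'I_n.+1 | (seqmax (natseq d) == n) && (tnth d i < L))
   a ^ L * a ^ sumn (natseq (f d).2))).
  by apply: leq_sum => d /andP[_]; apply: gw.
apply: (@leq_trans (\sum_(p : 'I_L.-1.+1 * m.-tuple 'I_n.+1 | seqmax (natseq p.2) == n)
   a ^ L * a ^ sumn (natseq p.2))).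
  apply: (leq_sum_inj (f := f) (fun p => a ^ L * a ^ sumn (natseq p.2))) => [d d'|d _].
    rewrite !unfold_in /= => /andP[_ ld] /andP[_ ld'] ef.
    have := congr1 (fun p => val p.1) ef; rewrite /= !inordK ?(prednK L0) // => ei.
    have eg : g d = g d' := congr1 snd ef.
    apply: eq_from_tnth => r; have [->|ri] := eqVneq r i; first exact: val_inj.
    by have := congr1 (fun t => tnth t r) eg; rewrite /= !tnth_mktuple (negbTE ri).
  by apply/eqP; apply: (@seqmax_natseq _ i); rewrite tnth_mktuple eqxx.
rewrite -(pair_big_dep predT (fun _ d => seqmax (natseq d) == n)
  (fun _ d => a ^ L * a ^ sumn (natseq d))) /=.
by rewrite sum_nat_const card_ord prednK // -mulnA -big_distrr.
Qed.

(** The decay is exponential in [n - L], but is weakened to order [L / n], the form found for the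
    sum length. For [n <= 2 * L] the bound is trivial; otherwise [n <= 2 * (n - L)], which is below
    [2 * a ^ (n - L)]. *)
Lemma short_weight_max :
  short_weight a m n seqmax L * n <= 2 * m.+1 * L * wt.
Proof.
have [nL|Ln] := leqP n (2 * L).
  apply: (@leq_trans (wt * (2 * L))); last by rewrite mulnC leq_mul2r; apply/orP; right; nia.
  apply: leq_mul => //; rewrite /weight /short_weight.
  rewrite [X in X <= _]big_mkcond [X in _ <= X]big_mkcond.
  by apply: leq_sum => d _; case: (_ == n) => //=; case: ifP.
have h := short_weight_le a m n seqmax L.
have {}h : short_weight a m n seqmax L * a ^ n <= m * (L * a ^ L * wt).
  apply: (@leq_trans (\sum_(i < m) short_weight_at a n seqmax L i * a ^ n)).
    by rewrite -big_distrl /= leq_mul2r h orbT.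
  rewrite -[X in _ <= X * _]card_ord -sum_nat_const.
  by apply: leq_sum => i _; apply: short_weight_at_max.
have e : a ^ n = a ^ L * a ^ (n - L) by rewrite -expnD subnKC //; lia.
have le : n <= 2 * a ^ (n - L).
  have := ltn_expl (n - L) a2; lia.
have aL : 0 < a ^ L by rewrite expn_gt0; lia.
rewrite e in h.
rewrite -(leq_pmul2l aL).
apply: (@leq_trans (2 * (short_weight a m n seqmax L * (a ^ L * a ^ (n - L))))).
  rewrite [X in X <= _](_ : _ = a ^ L * short_weight a m n seqmax L * n); last by lia.
  rewrite [X in _ <= X](_ : _ = a ^ L * short_weight a m n seqmax L * (2 * a ^ (n - L))).
    2: by lia.
  by rewrite leq_mul2l le orbT.
apply: (@leq_trans (2 * (m * (L * a ^ L * wt)))); first by rewrite leq_mul2l h orbT.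
by nia.
Qed.

End MaxShapes.

(** * Presentations as shaped words *)

(* A list of [k] relations is coded by the lengths of its [2 k] sides, all left
   sides first, and by the concatenation of these sides. *)
Section Enumeration.
Variables (A : finType).
Implicit Types (s : seq (relation A)) (ws : seq (seq A)).

Definition sides s : seq (seq A) := unzip1 s ++ unzip2 s.

Definition pair_up k ws : seq (relation A) := zip (take k ws) (drop k ws).

Definition rels_of k d (t : seq A) := pair_up k (reshape d t).

Lemma pair_upK k ws : size ws = k + k -> sides (pair_up k ws) = ws.
Proof.
move=> sw; have st : size (take k ws) = k by rewrite size_takel // sw leq_addr.
have sd : size (drop k ws) = k by rewrite size_drop sw addnK.
by rewrite /sides unzip1_zip ?unzip2_zip ?st ?sd // cat_take_drop.
Qed.

Lemma sidesK s : pair_up (size s) (sides s) = s.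
Proof.
rewrite /pair_up /sides take_size_cat ?size_map // drop_size_cat ?size_map //.
exact: zip_unzip.
Qed.

Lemma rels_ofK k d (t : seq A) : size d = k + k -> size t = sumn d ->
  sides (rels_of k d t) = reshape d t.
Proof. by move=> sd st; rewrite pair_upK // size_reshape. Qed.

Lemma size_rels_of k d (t : seq A) : size d = k + k -> size (rels_of k d t) = k.
Proof.
move=> sd; rewrite size_zip size_takel ?size_drop size_reshape sd ?leq_addr //.
by rewrite addnK minnn.
Qed.

Lemma mem_words_upto n (w : seq A) : (w \in words_upto A n) = (size w <= n).
Proof.
apply/flatten_mapP/idP => [[m]|le].
  by rewrite mem_iota ltnS => /= lem /mapP[t _ ->]; rewrite size_tuple.
exists (size w); first by rewrite mem_iota.
by apply/mapP; exists (in_tuple w) => //; rewrite mem_enum.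
Qed.

Variables (len : presentation A -> nat) (lenf : seq nat -> nat).
Hypothesis lenE : forall (R : presentation A) s, perm_eq s R ->
  len R = lenf (shape (sides s)).
Hypothesis lenf_ge : forall d x, x \in d -> x <= lenf d.

(* The factor [k`!] accounts for the orderings of the set of relations. *)
Lemma num_presE k n (P : presentation A -> Prop) :
  num_pres len k n P * k`! =
  \sum_(d : (k + k).-tuple 'I_n.+1 | lenf (natseq d) == n)
    #|[set t : (sumn (natseq d)).-tuple A | uniq (rels_of k (natseq d) t) &&
        `[< P (seq_fset tt (rels_of k (natseq d) t)) >]]|.
Proof.
(* [X] lists all orderings of the presentations counted, [Y] all lists decoded from shaped words.
   Both are duplicate-free with membership [Q], so their sizes agree. *)
pose Q s := [&& size s == k, uniq s, lenf (shape (sides s)) == n &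
             `[< P (seq_fset tt s) >]].
pose F := [fset R in fpowerset (rels_upto A n) |
  [&& #|` R| == k, len R == n & `[< P R >]]]%fset.
pose X := [seq s | R : presentation A <- F, s <- permutations (R : seq (relation A))].
pose C (d : (k + k).-tuple 'I_n.+1) := [set t : (sumn (natseq d)).-tuple A |
  uniq (rels_of k (natseq d) t) && `[< P (seq_fset tt (rels_of k (natseq d) t)) >]].
pose Y := [seq rels_of k (natseq d) (val t) |
  d <- enum (fun d : (k + k).-tuple 'I_n.+1 => lenf (natseq d) == n),
  t <- enum (C d)].
have permR (R : presentation A) s : perm_eq s R -> seq_fset tt s = R.
  by move=> sR; apply/fsetP => x; rewrite seq_fsetE (perm_mem sR).
have memX s : (s \in X) = Q s.
  apply/allpairsPdep/idP => [[R [s' [RF]]]|].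
    rewrite mem_permutations => s'R ->; move: RF; rewrite !inE /=.
    case/and4P=> _ cR lR PR; rewrite /Q (perm_size s'R) (perm_uniq s'R) fset_uniq.
    rewrite -(lenE s'R) (permR _ _ s'R) lR PR !andbT; exact: cR.
  case/and4P=> sk us ls Ps; exists (seq_fset tt s), s.
  have ps : perm_eq s (seq_fset tt s).
    by apply: uniq_perm => [||x]; rewrite ?fset_uniq // [RHS]seq_fsetE.
  rewrite mem_permutations ps; split=> //; rewrite !inE /= (lenE ps) ls Ps.
  rewrite -(perm_size ps) sk !andbT; rewrite fpowersetE; apply/fsubsetP => x.
  move=> xs0; have xs : x \in s := etrans (esym (seq_fsetE tt s x)) xs0.
  rewrite seq_fsetE; apply/allpairsP; exists x.
  rewrite !mem_words_upto -(eqP ls); split; last by case: x {xs0 xs}.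
    apply: lenf_ge; apply/mapP; exists x.1 => //.
    by rewrite mem_cat; apply/orP; left; apply/mapP; exists x.
  apply: lenf_ge; apply/mapP; exists x.2 => //.
  by rewrite mem_cat; apply/orP; right; apply/mapP; exists x.
have memY s : (s \in Y) = Q s.
  apply/allpairsPdep/idP => [[d [t []]]|].
    rewrite !mem_enum => ld; rewrite inE => /andP[ut Pt] ->.
    rewrite /Q size_rels_of ?size_natseq // eqxx ut Pt rels_ofK ?size_natseq ?size_tuple //.
    by rewrite reshapeKl ?size_tuple //; move: ld; rewrite unfold_in => ->.
  case/and4P=> /eqP sk us ls Ps.
  have sd : size (map (inord : nat -> 'I_n.+1) (shape (sides s))) == k + k.
    by rewrite !size_map size_cat !size_map sk.
  have ed : natseq (Tuple sd) = shape (sides s).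
    rewrite /natseq /= -map_comp map_id_in // => x xs /=; rewrite inordK // ltnS.
    by rewrite -(eqP ls); apply: lenf_ge.
  have st : size (flatten (sides s)) == sumn (natseq (Tuple sd)).
    by rewrite ed size_flatten.
  have es : rels_of k (natseq (Tuple sd)) (flatten (sides s)) = s.
    by rewrite /rels_of ed flattenK -sk sidesK.
  exists (Tuple sd), (Tuple st); rewrite !mem_enum; split=> //.
    by rewrite unfold_in /= ed.
  by rewrite inE /= es us Ps.
have uX : uniq X.
  apply: allpairs_uniq_dep => [||p p' /=].
  - exact: fset_uniq.
  - by move=> R _; apply: permutations_uniq.
  move=> /allpairsPdep[R1 [s1 [_ h1 ->]]] /allpairsPdep[R2 [s2 [_ h2 ->]]] /= es.
  by move: h1 h2; rewrite !mem_permutations es => /permR <- /permR <-.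
have uY : uniq Y.
  apply: allpairs_uniq_dep => [||[d t] [d' t'] _ _ /=].
  - exact: enum_uniq.
  - by move=> d _; apply: enum_uniq.
  move=> e; have := congr1 sides e; rewrite !rels_ofK ?size_natseq ?size_tuple // => e2.
  have := congr1 shape e2; rewrite !reshapeKl ?size_tuple // => /(inj_map val_inj)/val_inj ed.
  case: _ / ed t' e e2 => t' _ /(congr1 flatten).
  by rewrite !reshapeKr ?size_tuple // => /val_inj ->.
have: size X = size Y by apply/perm_size/uniq_perm => // s; rewrite memX memY.
rewrite /X /Y !size_allpairs_dep !sumnE !big_map => e.
transitivity (\sum_(R <- F) size (permutations (R : seq (relation A)))).
  rewrite big_seq (eq_bigr (fun=> k`!)) => [|R].
    by rewrite -big_seq big_const_seq count_predT iter_addn_0 mulnC.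
  by rewrite !inE => /and4P[_ /eqP <- _ _]; rewrite size_permutations // fset_uniq.
by apply: (etrans e); rewrite big_enum /=; apply: eq_bigr => d _; rewrite -cardE.
Qed.

End Enumeration.

(** * The congruence as existence of rewriting chains *)

Section Congruence.
Variables (A : finType) (R : presentation A).

Definition related (u v : seq A) : Prop := (u, v) \in R \/ (v, u) \in R.

Lemma congP u v : cong R u v <-> exists n, steps related n u v.
Proof.
split=> [|[n]].
  elim=> {u v} [u v uv|w|u v _ [n s]|u v w _ [n s] _ [m s']|x y u v _ [n s]].
  - exists 1, u => //; exists [::], u, v, [::]; rewrite !cats0; split=> //; by left.
  - by exists 0.
  - by exists n; apply: steps_sym s => a b [h|h]; [right|left].
  - by exists (n + m); apply: steps_trans s'.
  - by exists n; apply: steps_cat.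
elim: n v => [|n IH] v /=; first by move=> ->; apply: cong_refl.
case=> w /IH uw [p [a [b [s [ab ew ev]]]]]; apply: cong_trans uw _.
rewrite ew ev; apply: cong_compat; case: ab => h; first exact: cong_rel.
by apply: cong_sym; apply: cong_rel.
Qed.

Lemma left_cancellative_small_overlap l : small_overlap l related ->
  left_cancellative R <-> forall u v, related u v -> ohead u <> ohead v.
Proof.
move=> so; rewrite (steps_left_cancellative so); split=> lc x y z.
  by move/congP/lc/congP.
by move/congP/lc/congP.
Qed.

Lemma right_cancellative_small_overlap l : small_overlap l related ->
  right_cancellative R <-> forall u v, related u v -> ohead (rev u) <> ohead (rev v).
Proof.
move=> so; rewrite (steps_right_cancellative so); split=> lc x y z.
  by move/congP/lc/congP.
by move/congP/lc/congP.
Qed.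

End Congruence.

(** * Positions of the first and last letters of the sides *)

Definition head_pairs k d : seq (nat * nat) :=
  [seq (flatten_index d r 0, flatten_index d (k + r) 0) | r <- iota 0 k].

Definition last_pairs k d : seq (nat * nat) :=
  [seq (flatten_index d r (nth 0 d r).-1,
        flatten_index d (k + r) (nth 0 d (k + r)).-1) | r <- iota 0 k].

Section Positions.
Variables (k : nat) (d : seq nat).
Hypothesis sd : size d = k + k.
Hypothesis d2 : all (leq 2) d.

Let nth_d r : r < k + k -> 1 < nth 0 d r.
Proof. by move=> rk; apply: (allP d2); rewrite mem_nth // sd. Qed.

Let pos (o : nat -> nat) := [seq flatten_index d r (o r) | r <- iota 0 (k + k)].

Let iota_split : iota 0 (k + k) = iota 0 k ++ map (addn k) (iota 0 k).
Proof. by rewrite iotaD -iotaDl addn0. Qed.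

Let heads_pos : unzip1 (head_pairs k d) ++ unzip2 (head_pairs k d) = pos (fun=> 0).
Proof. by rewrite /pos iota_split map_cat /unzip1 /unzip2 -!map_comp. Qed.

Let lasts_pos : unzip1 (last_pairs k d) ++ unzip2 (last_pairs k d) =
  pos (fun r => (nth 0 d r).-1).
Proof. by rewrite /pos iota_split map_cat /unzip1 /unzip2 -!map_comp. Qed.

Let pos_uniq o : (forall r, r < k + k -> o r < nth 0 d r) -> uniq (pos o).
Proof.
move=> ho; rewrite map_inj_in_uniq ?iota_uniq // => r r'.
rewrite !mem_iota /= => hr hr' /(congr1 (reshape_index d)).
by rewrite !flatten_indexKl ?ho.
Qed.

Let pos_lt o : (forall r, r < k + k -> o r < nth 0 d r) ->
  all (gtn (sumn d)) (pos o).
Proof.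
move=> ho; apply/allP => p /mapP[r]; rewrite mem_iota /= => hr -> /=.
by apply: flatten_indexP; apply: ho.
Qed.

Let o0 r : r < k + k -> 0 < nth 0 d r. Proof. by move/nth_d; lia. Qed.
Let o1 r : r < k + k -> (nth 0 d r).-1 < nth 0 d r. Proof. by move/nth_d; lia. Qed.

Lemma head_pairs_ok :
  uniq (unzip1 (head_pairs k d) ++ unzip2 (head_pairs k d)) &&
  all (gtn (sumn d)) (unzip1 (head_pairs k d) ++ unzip2 (head_pairs k d)).
Proof. by rewrite heads_pos pos_uniq ?pos_lt. Qed.

Lemma last_pairs_ok :
  uniq (unzip1 (last_pairs k d) ++ unzip2 (last_pairs k d)) &&
  all (gtn (sumn d)) (unzip1 (last_pairs k d) ++ unzip2 (last_pairs k d)).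
Proof. by rewrite lasts_pos pos_uniq ?pos_lt. Qed.

(** Sides have at least two letters, so first and last letters have different offsets, which
    [reshape_offset] recovers from the positions. *)
Lemma head_last_pairs_ok (ps := head_pairs k d ++ last_pairs k d) :
  uniq (unzip1 ps ++ unzip2 ps) && all (gtn (sumn d)) (unzip1 ps ++ unzip2 ps).
Proof.
have e : perm_eq (unzip1 ps ++ unzip2 ps) (pos (fun=> 0) ++ pos (fun r => (nth 0 d r).-1)).
  by rewrite /unzip1 /unzip2 !map_cat perm_catACA -heads_pos -lasts_pos.
rewrite (perm_uniq e) (perm_all _ e) cat_uniq all_cat !pos_uniq ?pos_lt //= !andbT.
apply/hasPn => p /mapP[r]; rewrite mem_iota /= => hr ->.
apply/mapP => -[r']; rewrite mem_iota /= => hr' /(congr1 (reshape_offset d)).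
by rewrite !flatten_indexKr ?o0 ?o1 //; have := nth_d hr; lia.
Qed.

End Positions.

(** * Words without repeats give small overlaps *)

Section Generic.
Variables (A : finType) (x0 : A) (k l : nat) (d : seq nat) (t : seq A).
Hypotheses (l0 : 0 < l) (sd : size d = k + k) (dl : all (leq (3 * l)) d).
Hypotheses (st : size t = sumn d) (nrep : ~~ has_repeat x0 l (sumn d) t).

Local Notation ws := (reshape d t).
Local Notation R := (seq_fset tt (rels_of k d t) : presentation A).

Let sw : size ws = k + k. Proof. by rewrite size_reshape. Qed.

Let size_nth_ws r : size (nth [::] ws r) = nth 0 d r.
Proof. by rewrite -{2}(@reshapeKl _ d t) ?st // nth_shape. Qed.

Let nth_ws r c : c < nth 0 d r ->
  nth x0 (nth [::] ws r) c = nth x0 t (flatten_index d r c).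
Proof.
move=> hc; rewrite -[in RHS](@reshapeKr _ d t) ?st // nth_flatten reshapeKl ?st //.
by rewrite flatten_indexKl // flatten_indexKr.
Qed.

Let nth_dl r : r < k + k -> 3 * l <= nth 0 d r.
Proof. by move=> hr; apply: (allP dl); rewrite mem_nth // sd. Qed.

(** Two occurrences starting at different positions of [t] would form a repeat; [norep] excludes
    each order in turn. The common position then determines the side and the offset. *)
Let piece a b p x s p' s' : a < k + k -> b < k + k ->
  nth [::] ws a = p ++ x ++ s -> nth [::] ws b = p' ++ x ++ s' -> l <= size x ->
  a = b /\ size p = size p'.
Proof.
have sz c q r : nth [::] ws c = q ++ x ++ r -> nth 0 d c = size q + (size x + size r).
  by move=> e; rewrite -size_nth_ws e !size_cat.
have nth_t c q r z : nth [::] ws c = q ++ x ++ r -> z < size x ->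
    nth x0 t (flatten_index d c (size q) + z) = nth x0 x z.
  move=> e zx; rewrite -[_ + z]addnA -nth_ws ?(sz _ _ _ e); last by lia.
  by rewrite e nth_cat ltnNge leq_addr addKn nth_cat zx.
have norep a1 p1 s1 a2 p2 s2 : nth [::] ws a1 = p1 ++ x ++ s1 ->
    nth [::] ws a2 = p2 ++ x ++ s2 -> l <= size x ->
    flatten_index d a2 (size p2) <= flatten_index d a1 (size p1).
  move=> e1 e2 lx; rewrite leqNgt; apply/negP => lt.
  have bd : flatten_index d a2 (size p2) + l <= sumn d.
    (* [flatten_indexP] needs an offset inside the side, hence the last letter of the factor, at
       [l.-1]. *)
    have : size p2 + l.-1 < nth 0 d a2 by rewrite (sz _ _ _ e2); lia.
    by move/flatten_indexP; rewrite /flatten_index; lia.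
  have lt1 : flatten_index d a1 (size p1) < sumn d by lia.
  have lt2 : flatten_index d a2 (size p2) < sumn d by lia.
  move/existsP: nrep; apply; exists (Ordinal lt1, Ordinal lt2) => /=.
  rewrite lt bd; apply/forallP => -[c cl] /=.
  by rewrite (nth_t _ _ _ _ e1) ?(nth_t _ _ _ _ e2) //; lia.
move=> ha hb ea eb lx.
have e : flatten_index d a (size p) = flatten_index d b (size p').
  by apply/eqP; rewrite eqn_leq (norep _ _ _ _ _ _ eb ea) // (norep _ _ _ _ _ _ ea eb).
have h1 : size p < nth 0 d a by rewrite (sz _ _ _ ea); lia.
have h2 : size p' < nth 0 d b by rewrite (sz _ _ _ eb); lia.
split; first by have := congr1 (reshape_index d) e; rewrite !flatten_indexKl.
by have := congr1 (reshape_offset d) e; rewrite !flatten_indexKr.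
Qed.

Let nth_inj a b : a < k + k -> b < k + k -> nth [::] ws a = nth [::] ws b -> a = b.
Proof.
move=> ha hb e; have [] // := @piece a b [::] (nth [::] ws a) [::] [::] [::] ha hb.
- by rewrite cats0.
- by rewrite cats0.
- by rewrite size_nth_ws; have := nth_dl ha; lia.
Qed.

Lemma generic_uniq : uniq (rels_of k d t).
Proof.
have : uniq (sides (rels_of k d t)).
  rewrite rels_ofK //; apply/(uniqP [::]) => a b; rewrite !inE sw.
  exact: nth_inj.
by rewrite cat_uniq => /andP[/map_uniq].
Qed.

Let memR u v : (u, v) \in R ->
  exists r, [/\ r < k, u = nth [::] ws r & v = nth [::] ws (k + r)].
Proof.
rewrite seq_fsetE => /(nthP ([::], [::]))[r]; rewrite size_rels_of // => rk.
rewrite nth_zip; last by rewrite size_takel ?size_drop sw ?addnK ?leq_addr.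
by rewrite nth_take // nth_drop => -[<- <-]; exists r.
Qed.

Let memR_nth r : r < k -> (nth [::] ws r, nth [::] ws (k + r)) \in R.
Proof.
move=> rk; rewrite seq_fsetE; apply/(nthP ([::], [::])).
exists r; rewrite ?size_rels_of // nth_zip.
  2: by rewrite size_takel ?size_drop sw ?addnK ?leq_addr.
by rewrite nth_take // nth_drop.
Qed.

Let relatedP u v : related R u v -> exists a b, [/\ a < k + k, b < k + k,
  b = k + a \/ a = k + b, u = nth [::] ws a & v = nth [::] ws b].
Proof.
case=> /memR[r [rk eu ev]]; [exists r, (k + r)|exists (k + r), r]; split=> //; lia.
Qed.

Lemma generic_small_overlap : small_overlap l (related R).
Proof.
split=> //.
- by move=> u v [h|h]; [right|left].
- by move=> u /relatedP[a [b [ha hb ab -> e]]]; have := nth_inj ha hb e; lia.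
- move=> u v v' /relatedP[a [b [ha hb ab -> ->]]] /relatedP[a' [b' [ha' hb' ab' e ->]]].
  have ea := nth_inj ha ha' e; congr (nth _ _ _); lia.
- by move=> u v /relatedP[a [b [ha _ _ -> _]]]; rewrite size_nth_ws nth_dl.
- move=> u v u' v' p x s p' s' /relatedP[a [b [ha _ _ eu _]]].
  move=> /relatedP[a' [b' [ha' _ _ eu' _]]] e e' lx.
  rewrite eu in e; rewrite eu' in e'.
  have [eaa sp] := piece ha ha' e e' lx.
  move: e'; rewrite -eaa e => /eqP; rewrite eqseq_cat // => /andP[/eqP -> ].
  by rewrite eqseq_cat // => /andP[_ /eqP ->].
Qed.

(** One statement serves both ends: [f = id] for first letters and [f = rev] for last letters. *)
Let related_ohead (f : seq A -> seq A) (o : nat -> nat) :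
  (forall r, r < k + k -> ohead (f (nth [::] ws r)) = Some (nth x0 t (flatten_index d r (o r)))) ->
  reflect (forall u v, related R u v -> ohead (f u) <> ohead (f v))
    (distinct_at x0 [seq (flatten_index d r (o r), flatten_index d (k + r) (o (k + r)))
                    | r <- iota 0 k] t).
Proof.
move=> ho; apply: (iffP allP) => [da u v|H p /mapP[r] ].
  have da' r : r < k -> nth x0 t (flatten_index d r (o r)) <>
      nth x0 t (flatten_index d (k + r) (o (k + r))).
    by move=> rk; apply/eqP; apply: (da (_, _)); apply/mapP; exists r; rewrite ?mem_iota.
  by case=> /memR[r [rk -> ->]]; rewrite !ho; try lia; case=> e; apply: (da' r).
rewrite mem_iota /= => rk ->; apply/eqP => /= e.
apply: (H (nth [::] ws r) (nth [::] ws (k + r))); first by left; apply: memR_nth.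
by rewrite !ho ?e //; lia.
Qed.

Lemma generic_left_cancellative :
  left_cancellative R <-> distinct_at x0 (head_pairs k d) t.
Proof.
rewrite (left_cancellative_small_overlap generic_small_overlap).
apply: rwP; apply: (related_ohead (f := id) (o := fun=> 0)) => r hr.
rewrite -nth_ws; last by have := nth_dl hr; lia.
by have := size_nth_ws r; have := nth_dl hr; case: (nth [::] ws r) => //= + e; lia.
Qed.

Lemma generic_right_cancellative :
  right_cancellative R <-> distinct_at x0 (last_pairs k d) t.
Proof.
rewrite (right_cancellative_small_overlap generic_small_overlap).
apply: rwP; apply: (related_ohead (f := rev) (o := fun r => (nth 0 d r).-1)) => r hr.
have hd := nth_dl hr; rewrite -nth_ws -?size_nth_ws; last by rewrite size_nth_ws; lia.
have := size_nth_ws r; rewrite nth_last; case/lastP: (nth [::] ws r) => [|w a] /=; first by lia.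
by rewrite rev_rcons last_rcons.
Qed.

Lemma generic_cancellative :
  cancellative R <-> distinct_at x0 (head_pairs k d ++ last_pairs k d) t.
Proof.
rewrite /cancellative generic_left_cancellative generic_right_cancellative.
by rewrite /distinct_at all_cat; split=> /andP.
Qed.

End Generic.

Lemma sum_rel_lenE (A : finType) (R : presentation A) s : perm_eq s R ->
  sum_rel_len R = sumn (shape (sides s)).
Proof.
move=> sR; rewrite /sum_rel_len -(perm_big _ sR) /= big_split /=.
by rewrite sumnE big_map big_cat !big_map.
Qed.

Lemma max_rel_lenE (A : finType) (R : presentation A) s : perm_eq s R ->
  max_rel_len R = seqmax (shape (sides s)).
Proof.
move=> sR; rewrite /max_rel_len -(perm_big _ sR) /= big_split /=.
by rewrite /seqmax big_map big_cat !big_map.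
Qed.

Lemma sumn_ge (d : seq nat) x : x \in d -> x <= sumn d.
Proof. by move=> xd; rewrite sumnE (big_rem x) //= leq_addr. Qed.

Lemma weight_sum_gt0 a m n : 0 < a -> 0 < weight a m.+2 n sumn.
Proof. by move=> a0; rewrite weight_sum muln_gt0 expn_gt0 a0 bin_gt0 leq_addr. Qed.

Lemma weight_max_gt0 a m n : 0 < a -> 0 < m -> 0 < weight a m n seqmax.
Proof.
move=> a0 m0; pose d := [tuple of nseq m (ord_max : 'I_n.+1)].
rewrite /weight (bigD1 d) /=; first by rewrite addn_gt0 expn_gt0 a0.
by apply/eqP; apply: (seqmax_natseq (i := Ordinal m0)); rewrite tnth_nseq.
Qed.

(** * Limits *)

Lemma sqr_up_log n : 1 < n -> up_log 2 n ^ 2 <= 4 * n.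
Proof.
move=> n1; have u0 : 0 < up_log 2 n by rewrite up_log_gt0.
have := up_log_gtn (isT : 1 < 2) n1; case: (up_log 2 n) u0 => // j _ /= lt.
apply: (@leq_trans (4 * 2 ^ j)); last by rewrite leq_mul2l ltnW.
(* The inductive step needs [(x + 1) ^ 2 <= 2 * x ^ 2], true only from [x = 3] on, so two values are
   treated by hand. *)
case: j {lt} => [//|]; case=> [//|j].
elim: j => [//|j IH]; rewrite (expnS 2) -mulnn; move: IH; rewrite -mulnn.
by move: (2 ^ _) => c; nia.
Qed.

Lemma up_log_unbounded J n : 2 ^ J < n -> J < up_log 2 n.
Proof.
move=> lt; rewrite ltnNge; apply/negP => le.
have := leq_trans lt (up_logP n (isT : 1 < 2)).
by rewrite ltnNge leq_pexp2l.
Qed.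

Local Open Scope ring_scope.

(** * Counting presentations with an explicit error *)

Section Approximation.
Variables (Rl : realType) (A : finType) (x0 : A) (k : nat).
Hypothesis a2 : (1 < #|A|)%N.
Local Notation a := (#|A|%:R : Rl).
Local Notation q := ((a - 1) / a).

Let a0 : 0 < a. Proof. by rewrite ltr0n; lia. Qed.

Lemma ratio_expr_le1 m : 0 <= q ^+ m <= 1.
Proof.
have q0 : 0 <= q by rewrite divr_ge0 ?subr_ge0 ?ler1n //; lia.
rewrite exprn_ge0 //= exprn_ile1 // ler_pdivrMr // mul1r; lra.
Qed.

Lemma card_distinct_atR N ps :
  uniq (unzip1 ps ++ unzip2 ps) && all (gtn N) (unzip1 ps ++ unzip2 ps) ->
  #|[set t : N.-tuple A | distinct_at x0 ps t]|%:R = q ^+ size ps * a ^+ N.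
Proof.
case/andP=> u l; have := congr1 (fun n => n%:R : Rl) (card_distinct_at x0 u l).
rewrite !natrM !natrX natrB; last by lia.
move=> e; apply: (mulIf (expf_neq0 (size ps) (lt0r_neq0 a0))).
by rewrite e expr_div_n mulrAC divfK ?expf_neq0 ?lt0r_neq0 // mulrC.
Qed.

Variables (P : presentation A -> Prop) (ps : seq nat -> seq (nat * nat)) (m : nat).
Hypothesis ps_ok : forall d, size d = (k + k)%N -> all (leq 2) d ->
  uniq (unzip1 (ps d) ++ unzip2 (ps d)) &&
  all (gtn (sumn d)) (unzip1 (ps d) ++ unzip2 (ps d)).
Hypothesis size_ps : forall d, size (ps d) = m.
Hypothesis P_generic : forall l d t, (0 < l)%N -> size d = (k + k)%N ->
  all (leq (3 * l)) d -> size t = sumn d -> ~~ has_repeat x0 l (sumn d) t ->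
  P (seq_fset tt (rels_of k d t)) <-> distinct_at x0 (ps d) t.

Let num_words d := #|[set t : (sumn d).-tuple A |
  uniq (rels_of k d t) && `[< P (seq_fset tt (rels_of k d t)) >]]|.

(** Outside the words with a repeat, [P] amounts to the pairs being distinct, so the two counts
    differ by at most the number of words with a repeat. *)
Lemma count_long l d : (0 < l)%N -> size d = (k + k)%N -> (0 < k)%N ->
  all (leq (3 * l)) d ->
  `|q ^+ m * a ^+ sumn d - (num_words d)%:R| <= (sumn d ^ 2)%:R * (a ^+ sumn d / a ^+ l).
Proof.
move=> l0 sd k0 dl.
pose Y := [set t : (sumn d).-tuple A | distinct_at x0 (ps d) t].
pose Z := [set t : (sumn d).-tuple A | has_repeat x0 l (sumn d) t].
have eY : (#|Y|)%:R = q ^+ m * a ^+ sumn d.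
  rewrite -(size_ps d); apply: card_distinct_atR; apply: ps_ok => //.
  by apply: sub_all dl => x; lia.
have XY t : t \notin Z -> (t \in [set t : (sumn d).-tuple A |
    uniq (rels_of k d t) && `[< P (seq_fset tt (rels_of k d t)) >]]) = (t \in Y).
  rewrite !inE => nr; have st : size t = sumn d by rewrite size_tuple.
  rewrite (generic_uniq l0 sd dl st nr) /=.
  by apply/asboolP/idP => /(P_generic l0 sd dl st nr).
have leZ (U V : {set (sumn d).-tuple A}) :
    (forall t, t \notin Z -> t \in U -> t \in V) -> (#|U| <= #|V| + #|Z|)%N.
  move=> UV; apply: leq_trans (leq_card_setU V Z); apply: subset_leq_card.
  apply/fintype.subsetP => t tU; rewrite inE; have [tZ|tZ] := boolP (t \in Z).
    by rewrite orbT.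
  by rewrite UV.
have h1 : (num_words d <= #|Y| + #|Z|)%N by apply: leZ => t tZ; rewrite XY.
have h2 : (#|Y| <= num_words d + #|Z|)%N by apply: leZ => t tZ; rewrite XY.
have ld : (l <= sumn d)%N.
  suff h e : size e = (k + k)%N -> all (leq (3 * l)) e -> (l <= sumn e)%N by exact: h.
  by case: e => [|x e] /=; [lia|move=> _ /andP[]; lia].
have hZ : (#|Z|)%:R <= (sumn d ^ 2)%:R * (a ^+ sumn d / a ^+ l) :> Rl.
  have -> : a ^+ sumn d / a ^+ l = (#|A| ^ (sumn d - l))%:R.
    by rewrite -{1}(subnK ld) exprD mulfK ?expf_neq0 ?lt0r_neq0 // natrX.
  rewrite -natrM ler_nat.
  exact: card_has_repeat.
apply: le_trans hZ; rewrite -eY ler_norml.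
by rewrite -!(ler_nat Rl) !natrD in h1 h2; lra.
Qed.

Variables (len : presentation A -> nat) (lenf : seq nat -> nat).
Hypothesis lenE : forall (R : presentation A) s, perm_eq s R ->
  len R = lenf (shape (sides s)).
Hypothesis lenf_ge : forall d x, x \in d -> (x <= lenf d)%N.
Local Notation W n := (weight #|A| (k + k) n lenf).
Local Notation short n L := (short_weight #|A| (k + k) n lenf L).

(** For a shape with a short side both terms lie between 0 and the number of words, so their
    difference is at most its weight. For the other shapes [count_long] applies, with total length
    at most [(k + k) * n]. *)
Lemma num_pres_approx n l : (0 < l)%N -> (0 < k)%N ->
  `|q ^+ m * (W n)%:R - (num_pres len k n P * k`!)%:R| <=
  (short n (3 * l))%:R + (((k + k) * n) ^ 2)%:R * ((W n)%:R / a ^+ l).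
Proof.
move=> l0 k0; rewrite (num_presE lenE lenf_ge) /weight /short_weight !natr_sum.
rewrite mulr_sumr -sumrB; apply: (le_trans (ler_norm_sum _ _ _)).
rewrite (bigID (fun d : (k + k).-tuple 'I_n.+1 => all (leq (3 * l)) (natseq d))) /= addrC.
apply: lerD.
  apply: ler_sum => d _; rewrite natrX.
  have cl : (num_words (natseq d))%:R <= a ^+ sumn (natseq d).
    by rewrite -natrX ler_nat -card_tuple max_card.
  have /andP[q0 q1] := ratio_expr_le1 m.
  have aN : 0 <= a ^+ sumn (natseq d) by rewrite exprn_ge0 // ltW.
  have c0 : 0 <= (num_words (natseq d))%:R :> Rl by [].
  rewrite -/(num_words (natseq d)) ler_norml; nra.
rewrite [X in _ <= X]mulrA mulrAC mulr_sumr.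
have le0 (d : (k + k).-tuple 'I_n.+1) :
    0 <= (((k + k) * n) ^ 2)%:R / a ^+ l * (#|A| ^ sumn (natseq d))%:R :> Rl.
  by rewrite mulr_ge0 // divr_ge0 // exprn_ge0 // ltW.
apply: (@le_trans _ _ (\sum_(d : (k + k).-tuple 'I_n.+1 |
    (lenf (natseq d) == n) && all (leq (3 * l)) (natseq d))
   (((k + k) * n) ^ 2)%:R / a ^+ l * (#|A| ^ sumn (natseq d))%:R)); last first.
  rewrite [X in _ <= X](bigID (fun d : (k + k).-tuple 'I_n.+1 => all (leq (3 * l)) (natseq d))) /=.
  by rewrite lerDl sumr_ge0.
apply: ler_sum => d /andP[_ dl]; rewrite natrX.
apply: (le_trans (count_long l0 (size_natseq d) k0 dl)).
rewrite [leRHS]mulrAC -[leRHS]mulrA; apply: ler_wpM2r.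
  by rewrite divr_ge0 // exprn_ge0 // ltW.
rewrite ler_nat leq_sqr sumn_natseq.
apply: (@leq_trans (\sum_(r < k + k) n)); first by apply: leq_sum => r _; rewrite -ltnS.
by rewrite sum_nat_const card_ord.
Qed.

(** With [l = 3 * u], the power [a ^+ l] is at least [n ^ 3] and beats the [n ^ 2] of the repeats.
    Sides must then reach length [3 * l = 9 * u], whence [9 * C]. *)
Lemma num_pres_ratio C n : (0 < k)%N -> (1 < n)%N -> (0 < W n)%N ->
  (forall L, short n L * n <= C * L * W n)%N ->
  `|q ^+ m - (num_pres len k n P * k`!)%:R / (W n)%:R| <=
  (9 * C + (k + k) ^ 2)%:R * ((up_log 2 n)%:R / n%:R).
Proof.
move=> k0 n1 W0 hC.
have w0 : 0 < (W n)%:R :> Rl by rewrite ltr0n.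
have n0 : 0 < n%:R :> Rl by rewrite ltr0n; lia.
set u := up_log 2 n; have u0 : (0 < u)%N by rewrite up_log_gt0.
have := @num_pres_approx n (3 * u) _ k0; rewrite muln_gt0 u0 => /(_ isT) h.
rewrite -{1}[q ^+ m](mulfK (lt0r_neq0 w0)) -mulrBl normrM normfV (gtr0_norm w0) ler_pdivrMr //.
apply: (le_trans h).
have hS : (short n (3 * (3 * u)))%:R <= (9 * C)%:R * (u%:R / n%:R) * (W n)%:R :> Rl.
  rewrite mulrA mulrAC ler_pdivlMr // -!natrM ler_nat.
  by apply: (leq_trans (hC _)); rewrite leq_mul2r; apply/orP; right; lia.
have hA : n%:R ^+ 3 <= a ^+ (3 * u).
  rewrite -!natrX ler_nat mulnC expnM leq_exp2r //.
  apply: (leq_trans (up_logP n (isT : 1 < 2)%N)); rewrite -/u leq_exp2r //.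
have hR : (((k + k) * n) ^ 2)%:R * ((W n)%:R / a ^+ (3 * u)) <=
    ((k + k) ^ 2)%:R * (u%:R / n%:R) * (W n)%:R :> Rl.
  apply: (@le_trans _ _ ((((k + k) * n) ^ 2)%:R * ((W n)%:R / n%:R ^+ 3))).
    rewrite !ler_wpM2l // lef_pV2 // posrE exprn_gt0 //.
  rewrite expnMn natrM [X in X <= _](_ : _ = ((k + k) ^ 2)%:R * (1 / n%:R) * (W n)%:R).
    by rewrite ler_wpM2r // ler_wpM2l // ler_wpM2r ?invr_ge0 // ler1n.
  by rewrite (natrX _ n 2); field; rewrite lt0r_neq0.
rewrite natrD mulrDl mulrDl; exact: lerD.
Qed.

End Approximation.

Local Open Scope classical_set_scope.

(* [log n / n] tends to 0 because [log^2 n <= 4 n]. *)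
Lemma cvg_up_log_bound (Rl : realType) (f : nat -> Rl) (y K : Rl) :
  (forall n, (1 < n)%N -> `|y - f n| <= K * ((up_log 2 n)%:R / n%:R)) ->
  f @ \oo --> y.
Proof.
move=> fK; apply/cvgrPdist_le => e e0.
have K0 : 0 <= `|K| * 4 / e by rewrite divr_ge0 ?mulr_ge0 // ltW.
(* Since [u ^ 2 <= 4 * n] for [u = up_log 2 n], the error is at most [4 * |K| / u], which is at most
   [e] once [u] exceeds [J]. *)
pose J := (Num.truncn (`|K| * 4 / e)).+1.
have eJ : `|K| * 4 / e <= J%:R by apply: ltW; rewrite truncnS_gt.
exists (2 ^ J).+2 => // n /= nJ.
have Jn : (J < up_log 2 n)%N by apply: up_log_unbounded; lia.
have n1 : (1 < n)%N by lia.
apply: (le_trans (fK n n1)); apply: (le_trans (ler_norm _)); rewrite normrM.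
have u0 : 0 < (up_log 2 n)%:R :> Rl by rewrite ltr0n; lia.
have n0 : 0 < n%:R :> Rl by rewrite ltr0n; lia.
apply: (@le_trans _ _ (`|K| * (4 / (up_log 2 n)%:R))).
  apply: ler_wpM2l => //; rewrite ger0_norm ?divr_ge0 // ler_pdivrMr //.
  rewrite mulrAC ler_pdivlMr // -!natrM ler_nat mulnn; exact: sqr_up_log.
rewrite mulrA ler_pdivrMr // [leRHS]mulrC -ler_pdivrMr //; apply: (le_trans eJ).
by rewrite ler_nat ltnW.
Qed.

Section Limits.
Variables (Rl : realType) (A : finType) (k : nat).
Variables (len : presentation A -> nat) (lenf : seq nat -> nat) (C : nat).
Hypotheses (a2 : (1 < #|A|)%N) (k0 : (0 < k)%N).
Hypothesis lenE : forall (R : presentation A) s, perm_eq s R ->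
  len R = lenf (shape (sides s)).
Hypothesis lenf_ge : forall d x, x \in d -> (x <= lenf d)%N.
Local Notation W n := (weight #|A| (k + k) n lenf).
Hypothesis W0 : forall n, (0 < W n)%N.
Hypothesis short_negligible : forall n L,
  (short_weight #|A| (k + k) n lenf L * n <= C * L * W n)%N.
Local Notation q := ((#|A|%:R - 1) / #|A|%:R : Rl).

Lemma proportion_cvg (x0 : A) (P : presentation A -> Prop) ps m :
  (forall d, size d = (k + k)%N -> all (leq 2) d ->
    uniq (unzip1 (ps d) ++ unzip2 (ps d)) &&
    all (gtn (sumn d)) (unzip1 (ps d) ++ unzip2 (ps d))) ->
  (forall d, size (ps d) = m) ->
  (forall l d t, (0 < l)%N -> size d = (k + k)%N -> all (leq (3 * l)) d ->
    size t = sumn d -> ~~ has_repeat x0 l (sumn d) t ->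
    P (seq_fset tt (rels_of k d t)) <-> distinct_at x0 (ps d) t) ->
  (fun n => proportion Rl len k n P) @ \oo --> q ^+ m.
Proof.
move=> ps_ok size_ps Pgen.
have cP : (fun n => (num_pres len k n P * k`!)%:R / (W n)%:R : Rl) @ \oo --> q ^+ m.
  apply: (@cvg_up_log_bound _ _ _ (9 * C + (k + k) ^ 2)%:R) => n n1.
  by apply: (@num_pres_ratio _ _ x0 k a2 P ps).
(* The property [True] is the case of no pairs, with limit [q ^+ 0]. *)
have cT : (fun n => (num_pres len k n (fun=> True) * k`!)%:R / (W n)%:R : Rl) @ \oo --> (1 : Rl).
  rewrite -[1](expr0 q); apply: (@cvg_up_log_bound _ _ _ (9 * C + (k + k) ^ 2)%:R) => n n1.
  by apply: (@num_pres_ratio _ _ x0 k a2 (fun=> True) (fun=> [::])).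
(* The common factors cancel even when no presentation has length [n]: both sides are then quotients
   by 0, hence 0. *)
have -> : (fun n => proportion Rl len k n P) =
    (fun n => (num_pres len k n P * k`!)%:R / (W n)%:R /
              ((num_pres len k n (fun=> True) * k`!)%:R / (W n)%:R)).
  apply/funext => n; rewrite /proportion !natrM.
  have w0 : (W n)%:R != 0 :> Rl by rewrite pnatr_eq0 -lt0n.
  have f0 : k`!%:R != 0 :> Rl by rewrite pnatr_eq0 -lt0n fact_gt0.
  by rewrite !invfM invrK [RHS]mulrACA mulVf // mulr1 mulrACA divff // mulr1.
rewrite -[q ^+ m]divr1; apply: cvgM => //; apply: cvgV => //.
Qed.

Lemma cancellative_proportions :
  [/\ (fun n : nat => proportion Rl len k n (@left_cancellative A)) @ \oo --> q ^+ k,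
      (fun n : nat => proportion Rl len k n (@right_cancellative A)) @ \oo --> q ^+ k
    & (fun n : nat => proportion Rl len k n (@cancellative A)) @ \oo --> q ^+ (2 * k)].
Proof.
have [x0 _] : exists x0 : A, x0 \in A by apply/card_gt0P; exact: ltnW a2.
split.
- apply: (proportion_cvg (x0 := x0) (ps := head_pairs k)).
  + exact: head_pairs_ok.
  + by move=> d; rewrite size_map size_iota.
  + by move=> l d t; apply: generic_left_cancellative.
- apply: (proportion_cvg (x0 := x0) (ps := last_pairs k)).
  + exact: last_pairs_ok.
  + by move=> d; rewrite size_map size_iota.
  + by move=> l d t; apply: generic_right_cancellative.
- apply: (proportion_cvg (x0 := x0) (ps := fun d => head_pairs k d ++ last_pairs k d)).
  + exact: head_last_pairs_ok.
  + by move=> d; rewrite size_cat !size_map !size_iota addnn -mul2n.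
  + by move=> l d t; apply: generic_cancellative.
Qed.

End Limits.

Theorem theorem6 (Rl : realType) (A : finType) (k : nat) :
  (2 <= #|A|)%N -> (0 < k)%N ->
  let q : Rl := ((#|A|%:R - 1) / #|A|%:R) in
  [/\ (fun n : nat => proportion Rl (@sum_rel_len A) k n (@left_cancellative A))
        @ \oo --> q ^+ k,
      (fun n : nat => proportion Rl (@sum_rel_len A) k n (@right_cancellative A))
        @ \oo --> q ^+ k
    & (fun n : nat => proportion Rl (@sum_rel_len A) k n (@cancellative A))
        @ \oo --> q ^+ (2 * k)] /\
  [/\ (fun n : nat => proportion Rl (@max_rel_len A) k n (@left_cancellative A))
        @ \oo --> q ^+ k,
      (fun n : nat => proportion Rl (@max_rel_len A) k n (@right_cancellative A))
        @ \oo --> q ^+ k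
    & (fun n : nat => proportion Rl (@max_rel_len A) k n (@cancellative A))
        @ \oo --> q ^+ (2 * k)].
Proof.
(* The binomial formulas for the sum length take the number of sides in the form [m.+2], available
   since [k] is positive. *)
move=> a2 k0 q; have ek : (k + k)%N = (k + k).-2.+2 by lia.
split.
- apply: (@cancellative_proportions Rl A k _ sumn ((k + k) ^ 2)%N) => //.
  + exact: sum_rel_lenE.
  + exact: sumn_ge.
  + by move=> n; rewrite ek; apply: weight_sum_gt0; lia.
  + by move=> n L; rewrite ek; apply: short_weight_sum.
- apply: (@cancellative_proportions Rl A k _ seqmax (2 * (k + k).+1)%N) => //.
  + exact: max_rel_lenE.
  + exact: seqmax_ge.
  + by move=> n; apply: weight_max_gt0; lia.
  + by move=> n L; apply: short_weight_max.
Qed.
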